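(* There exist constants $c>0$ and $n_0$ such that for every $n\ge n_0$ the number of distinct K-USOs of the $n$-cube is at least $2^{c n^3}$; i.e., the number of $n$-dimensional K-USOs is $2^{\Omega(n^3)}$. Consequently (together with the upper bound $2^{O(n^3)}$ for P-USOs), the numbers of $n$-dimensional K-USOs and of P-USOs are both $2^{\Theta(n^3)}$.
   Context: For $v\in\{0,1\}^n$ and $I\subseteq[n]$, $v\oplus I$ flips the coordinates of $v$ in $I$; $v\oplus i=v\oplus\{i\}$. The $n$-cube has vertex set $\{0,1\}^n$ and edges $\{v,v\oplus i\}$; a unique-sink orientation (USO) is an orientation in which every subcube (induced subgraph on $\{v\oplus I: I\subseteq C\}$, $C\subseteq[n]$) has exactly one sink. A P-matrix is a square real matrix with all principal minors positive; a Z-matrix is a square matrix with all off-diagonal entries non-positive; a K-matrix is a matrix that is both a Z-matrix and a P-matrix. For $B\subseteq[n]$, $A_B$ is the matrix whose $i$th column is the $i$th column of $-M$ if $i\in B$ and of $I_n$ otherwise; $B(v)=\{j:v_j=1\}$. A pair $(M,q)$ with $M$ a P-matrix is nondegenerate if $(A_B^{-1}q)_i\ne0$ for all $B,i$; the USO induced by $\mathrm{LCP}(M,q)$ is given by $v\to v\oplus i$ iff $(A_{B(v)}^{-1}q)_i<0$. A K-USO (resp. P-USO) is a USO induced in this way by some nondegenerate $(M,q)$ with $M$ a K-matrix (resp. P-matrix). *)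

(* Defs.v *)
From HB Require Import structures.
From mathcomp Require Import all_boot all_order all_algebra.
From Stdlib Require Import ClassicalEpsilon.
Set Implicit Arguments. Unset Strict Implicit. Unset Printing Implicit Defensive.
Import Order.TTheory GRing.Theory Num.Theory.
Local Open Scope ring_scope.

Definition asbool (P : Prop) : bool :=
  if excluded_middle_informative P then true else false.

Definition vertex (n : nat) := {ffun 'I_n -> bool}.

Definition flip n (v : vertex n) (I : {set 'I_n}) : vertex n :=
  [ffun j => addb (v j) (j \in I)].

Definition Bset n (v : vertex n) : {set 'I_n} := [set j | v j].

(* An orientation of the n-cube is encoded by its out-map:
   s v = the set of directions i such that the edge {v, v (+) i} is
   oriented v -> v (+) i. *)
Definition outmap (n : nat) := {ffun vertex n -> {set 'I_n}}.

Definition is_orientation n (s : outmap n) : Prop :=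
  forall (v : vertex n) (i : 'I_n),
    (i \in s v) = ~~ (i \in s (flip v [set i])).

Definition subcube n (v : vertex n) (C : {set 'I_n}) : {set vertex n} :=
  [set flip v I | I in powerset C].

Definition is_USO n (s : outmap n) : Prop :=
  is_orientation s /\
  forall (v : vertex n) (C : {set 'I_n}),
    #|[set w in subcube v C | s w :&: C == set0]| = 1%N.

Section Matrices.
Variable R : rcfType.

Definition principal_submx n (M : 'M[R]_n) (S : {set 'I_n}) : 'M[R]_#|S| :=
  \matrix_(i, j) M (enum_val i) (enum_val j).

Definition P_matrix n (M : 'M[R]_n) : Prop :=
  forall S : {set 'I_n}, 0 < \det (principal_submx M S).

Definition Z_matrix n (M : 'M[R]_n) : Prop :=
  forall i j : 'I_n, i != j -> M i j <= 0.

Definition K_matrix n (M : 'M[R]_n) : Prop := Z_matrix M /\ P_matrix M.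

Definition A_mat n (M : 'M[R]_n) (B : {set 'I_n}) : 'M[R]_n :=
  \matrix_(i, j) (if j \in B then - M i j else (i == j)%:R).

Definition Ainvq n (M : 'M[R]_n) (q : 'cV[R]_n) (B : {set 'I_n}) (i : 'I_n) : R :=
  (invmx (A_mat M B) *m q) i 0.

Definition nondegenerate n (M : 'M[R]_n) (q : 'cV[R]_n) : Prop :=
  forall (B : {set 'I_n}) (i : 'I_n), Ainvq M q B i != 0.

(* s is the orientation induced by LCP(M,q): v -> v (+) i iff (A_{B(v)}^{-1} q)_i < 0. *)
Definition induced_by n (M : 'M[R]_n) (q : 'cV[R]_n) (s : outmap n) : Prop :=
  forall (v : vertex n) (i : 'I_n), (i \in s v) = (Ainvq M q (Bset v) i < 0).

Definition is_KUSO n (s : outmap n) : Prop :=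
  is_USO s /\ exists (M : 'M[R]_n) (q : 'cV[R]_n),
    [/\ K_matrix M, nondegenerate M q & induced_by M q s].

Definition is_PUSO n (s : outmap n) : Prop :=
  is_USO s /\ exists (M : 'M[R]_n) (q : 'cV[R]_n),
    [/\ P_matrix M, nondegenerate M q & induced_by M q s].

Definition num_KUSO (n : nat) : nat := #|[set s : outmap n | asbool (is_KUSO s)]|.
Definition num_PUSO (n : nat) : nat := #|[set s : outmap n | asbool (is_PUSO s)]|.

End Matrices.

(* Main.v *)
Require Import Defs.
From HB Require Import structures.
From mathcomp Require Import all_boot all_order all_algebra.
From mathcomp Require Import polyrcf ordered_qelim qe_rcf.
From mathcomp Require Import perm mpoly.
From mathcomp Require Import ring lra zify.
From Stdlib Require Import ClassicalEpsilon FunctionalExtensionality.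
Set Implicit Arguments. Unset Strict Implicit. Unset Printing Implicit Defensive.
Import Order.TTheory GRing.Theory Num.Theory.
Local Open Scope ring_scope.

(** Lower bound: for a K-matrix with unit diagonal whose only other nonzero entries are
    [M i j = - 2 w i j] with [i] in a set [T] of tests and [j] outside it, the induced
    orientation compares the sums [\sum_(j in D) w i j], for all [D] disjoint from [T],
    with a threshold.  A ruler of weights [1, 2, 4, ...] then reads off
    [w i j < 2 ^ (n / 3)] exactly, for [(n / 3) ^ 2] independent entries.

    Upper bound: a P-USO is a sign pattern of [n 2^n] polynomials of degree [O(n)] in the
    [n^2 + n] entries of [M] and [q].  Every region given by strict sign conditions on
    [f_1, ..., f_m] contains a critical point of [\prod_j f_j ^ 2 - eps * \sum_i x_i ^ k]
    for suitable [eps] and [k], and the critical equations allow reducing all monomials, so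
    the number of such points is bounded by a dimension count.  Over an arbitrary real
    closed field the maximum that yields the critical point exists by quantifier elimination:
    bounded definable subsets of the line have suprema. *)

Lemma asboolP (P : Prop) : reflect P (asbool P).
Proof. by rewrite /asbool; case: excluded_middle_informative => H; constructor. Qed.

(** * Definable subsets of a real closed field *)

Section Definable.
Variable R : rcfType.

Lemma rterm_univariate (t : GRing.term R) (e : seq R) i :
  GRing.rterm t -> exists p : {poly R}, forall x, GRing.eval (set_nth 0 e i x) t = p.[x].
Proof.
elim: t => //=.
- move=> j _; case: (eqVneq j i) => [->|nji].
    by exists 'X => x; rewrite hornerX nth_set_nth /= eqxx.
  by exists (e`_j)%:P => x; rewrite hornerC nth_set_nth /= (negPf nji).
- by move=> c _; exists c%:P => x; rewrite hornerC.
- by move=> k _; exists (k%:R)%:P => x; rewrite hornerC.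
- move=> a IHa b IHb /andP[/IHa[p Hp] /IHb[q Hq]].
  by exists (p + q) => x; rewrite hornerD Hp Hq.
- by move=> a IHa /IHa[p Hp]; exists (- p) => x; rewrite hornerN Hp.
- by move=> a IHa k /IHa[p Hp]; exists (p *+ k) => x; rewrite hornerMn Hp.
- move=> a IHa b IHb /andP[/IHa[p Hp] /IHb[q Hq]].
  by exists (p * q) => x; rewrite hornerM Hp Hq.
- by move=> a IHa k /IHa[p Hp]; exists (p ^+ k) => x; rewrite horner_exp Hp.
Qed.

Definition avoids (rs : seq R) (x y : R) := forall r, r \in rs -> ~~ (x <= r <= y).

(** The exceptional points are the roots of [p]: by the intermediate value theorem, a change of sign
    between [x] and [y] would produce a root there. *)
Lemma sgr_piecewise (p : {poly R}) :
  exists rs, forall x y, x <= y -> avoids rs x y -> Num.sg p.[x] = Num.sg p.[y].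
Proof.
case: (eqVneq p 0) => [->|p0]; first by exists [::] => x y _ _; rewrite !horner0.
exists (rootsR p) => x y lexy Hrs.
have noroot z : x <= z <= y -> p.[z] != 0.
  move=> Hz; apply/negP => /eqP pz; have := roots_on_rootsR p0.
  move=> /(_ z); rewrite in_itv /= rootE pz eqxx => zr.
  by have := Hrs z (esym zr); rewrite Hz.
have [pos|le0] := ltP 0 (p.[x] * p.[y]).
  have : Num.sg (p.[x] * p.[y]) = 1 by apply/eqP; rewrite sgr_cp0.
  rewrite sgrM; case: (sgrP p.[x]) => _; case: (sgrP p.[y]) => _ //; lra.
have [z Hz /eqP zr] := polyrcf.poly_ivt lexy le0.
by have := noroot z; rewrite zr eqxx => /(_ Hz).
Qed.

(** Each atom is a sign condition on the difference of two univariate polynomials; connectives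
    concatenate the lists of exceptional points. *)
Lemma qf_piecewise (f : ord.formula R) e i :
  ord.qf_form f && ord.rformula f ->
  exists rs, forall x y, x <= y -> avoids rs x y ->
    ord.qf_eval (set_nth 0 e i x) f = ord.qf_eval (set_nth 0 e i y) f.
Proof.
have avl rs1 rs2 x y : avoids (rs1 ++ rs2) x y -> avoids rs1 x y.
  by move=> H r Hr; apply: H; rewrite mem_cat Hr.
have avr rs1 rs2 x y : avoids (rs1 ++ rs2) x y -> avoids rs2 x y.
  by move=> H r Hr; apply: H; rewrite mem_cat Hr orbT.
have atom t1 t2 : GRing.rterm t1 && GRing.rterm t2 -> exists rs, forall x y, x <= y -> avoids rs x y ->
    Num.sg (GRing.eval (set_nth 0 e i x) t1 - GRing.eval (set_nth 0 e i x) t2)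
    = Num.sg (GRing.eval (set_nth 0 e i y) t1 - GRing.eval (set_nth 0 e i y) t2).
  move=> /andP[/(rterm_univariate e i)[p Hp] /(rterm_univariate e i)[q Hq]].
  have [rs Hrs] := sgr_piecewise (p - q).
  by exists rs => x y lxy /(Hrs x y lxy); rewrite !Hp !Hq !hornerE.
elim: f => //=.
- by move=> b _; exists [::].
- move=> t1 t2 /atom[rs Hrs]; exists rs => x y lxy /(Hrs x y lxy) Hs.
  by rewrite -subr_eq0 -sgr_eq0 Hs sgr_eq0 subr_eq0.
- move=> t1 t2 /atom[rs Hrs]; exists rs => x y lxy /(Hrs x y lxy) Hs.
  by rewrite -subr_lt0 -sgr_lt0 Hs sgr_lt0 subr_lt0.
- move=> t1 t2 /atom[rs Hrs]; exists rs => x y lxy /(Hrs x y lxy) Hs.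
  by rewrite -subr_le0 -sgr_le0 Hs sgr_le0 subr_le0.
- move=> f IHf g IHg /andP[/andP[qf qg] /andP[rf rg]].
  have [|rs Hrs] := IHf; first by rewrite qf rf.
  have [|rs' Hrs'] := IHg; first by rewrite qg rg.
  by exists (rs ++ rs') => x y lxy H; rewrite (Hrs x y) ?(Hrs' x y) //; [apply: avr H|apply: avl H].
- move=> f IHf g IHg /andP[/andP[qf qg] /andP[rf rg]].
  have [|rs Hrs] := IHf; first by rewrite qf rf.
  have [|rs' Hrs'] := IHg; first by rewrite qg rg.
  by exists (rs ++ rs') => x y lxy H; rewrite (Hrs x y) ?(Hrs' x y) //; [apply: avr H|apply: avl H].
- move=> f IHf g IHg /andP[/andP[qf qg] /andP[rf rg]].
  have [|rs Hrs] := IHf; first by rewrite qf rf.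
  have [|rs' Hrs'] := IHg; first by rewrite qg rg.
  by exists (rs ++ rs') => x y lxy H; rewrite (Hrs x y) ?(Hrs' x y) //; [apply: avr H|apply: avl H].
- by move=> f IHf /IHf[rs Hrs]; exists rs => x y lxy H; rewrite (Hrs x y).
Qed.

Definition is_lub (S : R -> Prop) (c : R) :=
  (forall y, S y -> y <= c) /\ (forall y, y < c -> exists2 z, S z & y < z).

(** Induction on the break points: truncating the argument of [S] on one side of [r] removes the
    break point [r] and keeps the supremum. Without break points, a nonempty [S] would be
    unbounded. *)
Lemma piecewise_lub (rs : seq R) (S : R -> Prop) :
  (forall x y, x <= y -> avoids rs x y -> (S x <-> S y)) ->
  (exists y, S y) -> (exists M, forall y, S y -> y <= M) -> exists c, is_lub S c.
Proof.
elim: rs S => [|r rs IH] S HS [s0 Hs0] [M HM].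
  have leM := HM _ Hs0.
  have : S (M + 1) by apply/(HS s0) => //; lra.
  by move/HM; lra.
have avc x y : avoids rs x y -> ~~ (x <= r <= y) -> avoids (r :: rs) x y.
  by move=> H1 H2 z; rewrite inE => /orP[/eqP->|/H1].
have avsub x y x' y' : avoids rs x y -> x <= x' -> y' <= y -> avoids rs x' y'.
  move=> H lx ly z /H; apply: contra => /andP[lz gz].
  by rewrite (le_trans lx lz) (le_trans gz ly).
case: (classic (forall y, S y -> y <= r)) => [Tr|nTr].
  case: (classic (is_lub S r)) => [|nlub]; first by exists r.
  have [y0 ltr T0] : exists2 y0, y0 < r & forall y, S y -> y <= y0.
    apply: NNPP => H; apply: nlub; split=> // y ltyr.
    apply: NNPP => H'; apply: H; exists y => // z Sz.
    by rewrite leNgt; apply/negP => ltyz; apply: H'; exists z.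
  (* Neither [y1] nor any larger point lies in [S], so truncating at [y1 < r] changes nothing and
     [r] ceases to be a break point. *)
  pose y1 := (y0 + r) / 2.
  have y1P : y0 < y1 < r by rewrite /y1; apply/andP; split; lra.
  have {y1P} [lt01 lt1r] := andP y1P.
  have Smin z : S z <-> S (Order.min z y1).
    rewrite /Order.min; case: ifP => // /negbT; rewrite -leNgt => lez.
    by split=> /T0; lra.
  apply: IH; [|by exists s0|by exists M].
  move=> x y lexy av; rewrite (Smin x) (Smin y).
  rewrite /Order.min; case: ifP => [ltx|/negbT nltx]; case: ifP => [lty|/negbT nlty] //.
  - apply: HS => //; apply: avc => //; apply/negP => /andP[]; lra.
  - rewrite -leNgt in nlty; apply: HS; first exact: ltW.
    apply: avc; first by apply: avsub av _ _.
    by apply/negP => /andP[]; lra.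
  - by move: nltx; rewrite -leNgt => ?; exfalso; lra.
have [s Ss lts] : exists2 s, S s & r < s.
  apply: NNPP => H; apply: nTr => y Sy; rewrite leNgt; apply/negP => lty.
  by apply: H; exists y.
(* This adds to [S] all points below its member [s], which hides the break point [r < s] and leaves
   the supremum unchanged. *)
have [|||c [c1 c2]] := IH (fun x => S (Order.max x s)).
- move=> x y lexy av; rewrite /Order.max; case: ifP => [ltx|/negbT nltx]; case: ifP => [lty|/negbT nlty] //.
  + rewrite -leNgt in nlty; apply: HS => //; apply: avc; first by apply: avsub av _ _ => //; exact: ltW.
    by apply/negP => /andP[]; lra.
  + by move: nltx; rewrite -leNgt => ?; exfalso; lra.
  + rewrite -leNgt in nltx; apply: HS => //; apply: avc => //; apply/negP => /andP[]; lra.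
- by exists s; rewrite maxxx.
- exists M => y; rewrite /Order.max; case: ifP => [lty /HM|_ /HM //]; lra.
have lesc : s <= c by apply: c1; rewrite maxxx.
exists c; split=> [y Sy|y /c2[z Sz ltyz]].
  have [ltys|leys] := ltP y s; first by lra.
  by apply: c1; rewrite /Order.max ltNge leys.
by exists (Order.max z s) => //; rewrite lt_max ltyz.
Qed.

Definition definable (P : seq R -> Prop) :=
  exists f : ord.formula R, forall e, P e <-> ord.holds e f.

(** Quantifier elimination makes the condition on the [i]th variable quantifier-free, hence
    piecewise constant. *)
Lemma definable_lub (P : seq R -> Prop) e i :
  definable P -> (exists y, P (set_nth 0 e i y)) ->
  (exists M, forall y, P (set_nth 0 e i y) -> y <= M) ->
  exists c, is_lub (fun y => P (set_nth 0 e i y)) c.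
Proof.
move=> [f Hf] ne bd.
pose g := ord.quantifier_elim (@wproj R) (ord.to_rform f).
have gqf : ord.qf_form g && ord.rformula g.
  apply: ord.quantifier_elim_wf; last exact: ord.to_rform_rformula.
  exact: wf_QE_wproj.
have Hg e' : P e' <-> ord.qf_eval e' g.
  rewrite Hf; apply: (rwP (rcf_satP e' f)).
have [rs Hrs] := qf_piecewise e i gqf.
by apply: (@piecewise_lub rs) => // x y lexy av; rewrite !Hg (Hrs x y).
Qed.

End Definable.

(** * Closure properties of definability, and limit points of definable families *)

Section DefinableClosure.
Variable R : rcfType.

Definition is_term_fun (g : seq R -> R) :=
  exists t : GRing.term R, forall e, g e = GRing.eval e t.

Lemma term_fun_var i : is_term_fun (fun e => e`_i).
Proof. by exists (GRing.Var R i). Qed.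

Lemma term_fun_const c : is_term_fun (fun=> c).
Proof. by exists (GRing.Const c). Qed.

Lemma term_fun_add g h : is_term_fun g -> is_term_fun h -> is_term_fun (fun e => g e + h e).
Proof. by move=> [a Ha] [b Hb]; exists (GRing.Add a b) => e; rewrite Ha Hb. Qed.

Lemma term_fun_opp g : is_term_fun g -> is_term_fun (fun e => - g e).
Proof. by move=> [a Ha]; exists (GRing.Opp a) => e; rewrite Ha. Qed.

Lemma term_fun_mul g h : is_term_fun g -> is_term_fun h -> is_term_fun (fun e => g e * h e).
Proof. by move=> [a Ha] [b Hb]; exists (GRing.Mul a b) => e; rewrite Ha Hb. Qed.

Lemma term_fun_exp g k : is_term_fun g -> is_term_fun (fun e => g e ^+ k).
Proof. by move=> [a Ha]; exists (GRing.Exp a k) => e; rewrite Ha. Qed.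

Lemma term_fun_sum (I : Type) (l : seq I) (g : I -> seq R -> R) :
  (forall i, is_term_fun (g i)) -> is_term_fun (fun e => \sum_(i <- l) g i e).
Proof.
move=> H; elim: l => [|i l [t Ht]].
  by exists (GRing.Const 0) => e; rewrite big_nil.
by have [a Ha] := H i; exists (GRing.Add a t) => e; rewrite big_cons Ha Ht.
Qed.

Lemma term_fun_prod (I : Type) (l : seq I) (g : I -> seq R -> R) :
  (forall i, is_term_fun (g i)) -> is_term_fun (fun e => \prod_(i <- l) g i e).
Proof.
move=> H; elim: l => [|i l [t Ht]].
  by exists (GRing.Const 1) => e; rewrite big_nil.
by have [a Ha] := H i; exists (GRing.Mul a t) => e; rewrite big_cons Ha Ht.
Qed.

Lemma term_fun_meval N (p : {mpoly R[N]}) (v : 'I_N -> nat) :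
  is_term_fun (fun e => p.@[fun i => e`_(v i)]).
Proof.
have [t Ht] : is_term_fun (fun e => \sum_(m <- msupp p) p@_m * \prod_i e`_(v i) ^+ m i).
  apply: term_fun_sum => m; apply: term_fun_mul; first exact: term_fun_const.
  by apply: term_fun_prod => i; apply/term_fun_exp/term_fun_var.
by exists t => e; rewrite mevalE Ht.
Qed.

Lemma definable_le g h : is_term_fun g -> is_term_fun h ->
  definable (fun e : seq R => g e <= h e).
Proof. by move=> [a Ha] [b Hb]; exists (ord.Le a b) => e; rewrite Ha Hb. Qed.

Lemma definable_lt g h : is_term_fun g -> is_term_fun h ->
  definable (fun e : seq R => g e < h e).
Proof. by move=> [a Ha] [b Hb]; exists (ord.Lt a b) => e; rewrite Ha Hb. Qed.

Lemma definable_and P Q : definable P -> definable Q ->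
  definable (fun e : seq R => P e /\ Q e).
Proof. by move=> [f Hf] [g Hg]; exists (ord.And f g) => e; rewrite Hf Hg. Qed.

Lemma definable_imply P Q : definable P -> definable Q ->
  definable (fun e : seq R => P e -> Q e).
Proof. by move=> [f Hf] [g Hg]; exists (ord.Implies f g) => e; rewrite Hf Hg. Qed.

Lemma definable_not P : definable P -> definable (fun e : seq R => ~ P e).
Proof. by move=> [f Hf]; exists (ord.Not f) => e; rewrite Hf. Qed.

Lemma definable_all (J : eqType) (l : seq J) (P : J -> seq R -> Prop) :
  (forall j, definable (P j)) -> definable (fun e => forall j, j \in l -> P j e).
Proof.
move=> H; elim: l => [|j l [f Hf]]; first by exists (ord.Bool true).
have [g Hg] := H j; exists (ord.And g f) => e /=; rewrite -Hf -Hg; split.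
  by move=> HP; split=> [|i il]; apply: HP; rewrite inE ?eqxx ?il ?orbT.
by move=> [Pj HP] i; rewrite inE => /orP[/eqP->|/HP].
Qed.

(** Quantification over a block of variables. Environments are compared entrywise because [set_nth]
    may pad them with zeros. *)
Lemma definable_forall (l : seq nat) P : definable P ->
  definable (fun e : seq R =>
    forall e' : seq R, (forall j, j \notin l -> e'`_j = e`_j) -> P e').
Proof.
move=> [f Hf]; exists (foldr ord.Forall f l).
elim: l => [|i l IH] e /=.
  split=> [H|H e' He']; first exact/Hf/H.
  by apply/Hf; apply: (ord.eq_holds _ H) => j; rewrite He'.
split=> [H x|H e' He'].
  apply/IH => e' He'; apply: H => j; rewrite inE negb_or => /andP[ji /He' ->].
  by rewrite nth_set_nth /= (negPf ji).
have /IH := H e'`_i; apply=> j jl; rewrite nth_set_nth /=.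
by case: eqP => [->//|/eqP ji]; apply: He'; rewrite inE negb_or ji.
Qed.

Lemma env_with_block N (v : 'I_N -> R) (e : seq R) :
  exists e' : seq R, (fun i : 'I_N => e'`_i) = v /\
    forall j, j \notin iota 0 N -> e'`_j = e`_j.
Proof.
have sz : size [seq v i | i <- enum 'I_N] = N by rewrite size_map size_enum_ord.
exists ([seq v i | i <- enum 'I_N] ++ drop N e); split.
  apply: functional_extensionality => i.
  by rewrite nth_cat sz ltn_ord (nth_map i) ?size_enum_ord // nth_ord_enum.
move=> j; rewrite mem_iota /= add0n -leqNgt => leNj.
by rewrite nth_cat sz ltnNge leNj /= nth_drop subnKC.
Qed.

(* Variables [0 .. N-1] hold the point, variable [N] the parameter of the family. *)
Definition definable_family N (P : ('I_N -> R) -> R -> Prop) :=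
  definable (fun e : seq R => P (fun i => e`_i) e`_N).

Lemma family_lub N (P : ('I_N -> R) -> R -> Prop) :
  definable_family P -> (exists t v, P v t) -> (exists M, forall t v, P v t -> t <= M) ->
  exists c, is_lub (fun t => exists v, P v t) c.
Proof.
move=> defP [t0 [v0 P0]] [M HM].
(* The existential over the point is written as a negated universal over the first [N] variables. *)
pose Q (e : seq R) := ~ forall e' : seq R, (forall j, j \notin iota 0 N -> e'`_j = e`_j) ->
  ~ P (fun i => e'`_i) e'`_N.
have defQ : definable Q by apply: definable_not; apply: definable_forall; apply: definable_not.
have QP t : Q (set_nth 0 [::] N t) <-> exists v, P v t.
  split=> [HQ|[v Pv] HQ].
    apply: NNPP => nP; apply: HQ => e' He' Pe'; apply: nP; exists (fun i => e'`_i).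
    have eN : e'`_N = t by rewrite He' ?nth_set_nth /= ?eqxx // mem_iota /= add0n ltnn.
    by rewrite -eN.
  have [e' [ev He']] := env_with_block v (set_nth 0 [::] N t).
  apply: (HQ e' He'); rewrite ev.
  have -> // : e'`_N = t by rewrite He' ?nth_set_nth /= ?eqxx // mem_iota /= add0n ltnn.
have [||c [c1 c2]] := @definable_lub R Q [::] N defQ.
- by exists t0; apply/QP; exists v0.
- by exists M => t /QP[v /HM].
by exists c; split=> [y /QP/c1 //|y /c2[z /QP Hz lt]]; exists z.
Qed.

(** The witness is the limit inferior of the [k]th coordinate over the sets [P _ s] as [s] tends to
    0, that is, the supremum of its eventual lower bounds. *)
Lemma nested_coordinate N (P : ('I_N -> R) -> R -> Prop) (k : 'I_N) :
  definable_family P ->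
  (forall s, 0 < s -> exists v, P v s) ->
  (forall v s s', s <= s' -> P v s -> P v s') ->
  (exists B, forall v s i, P v s -> `|v i| <= B) ->
  exists c, forall s, 0 < s -> exists v, P v s /\ `|v k - c| <= s.
Proof.
move=> defP ne mono [B HB].
pose S y := exists2 s, 0 < s & forall v, P v s -> y <= v k.
have [c [c1 c2]] : exists c, is_lub S c.
  (* Variable [N.+1] holds the candidate lower bound [y]; the outer quantifier ranges over the
     parameter, the inner one over the points. *)
  pose Q (e : seq R) := ~ forall e' : seq R, (forall j, j \notin [:: N] -> e'`_j = e`_j) ->
    ~ (0 < e'`_N /\ forall e'' : seq R, (forall j, j \notin iota 0 N -> e''`_j = e'`_j) ->
     P (fun i => e''`_i) e''`_N -> e''`_N.+1 <= e''`_k).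
  have defQ : definable Q.
    apply: definable_not; apply: definable_forall; apply: definable_not.
    apply: definable_and; first by apply: definable_lt; [apply: term_fun_const|apply: term_fun_var].
    apply: definable_forall; apply: definable_imply => //.
    by apply: definable_le; apply: term_fun_var.
  have QS y : Q (set_nth 0 [::] N.+1 y) <-> S y.
    split.
      move=> HQ; apply: NNPP => nS; apply: HQ => e' He' [s0 Hs].
      apply: nS; exists e'`_N => // v Pv.
      have [e'' [ev He'']] := env_with_block v e'.
      have eN : e''`_N = e'`_N by apply: He''; rewrite mem_iota /= add0n ltnn.
      have eN1 : e''`_N.+1 = y.
        rewrite He'' ?mem_iota /= ?add0n ?ltnNge ?leqnSn //.
        by rewrite He' ?nth_set_nth /= ?eqxx // inE gtn_eqF.
      have evk : e''`_k = v k by rewrite -ev.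
      by have := Hs e'' He''; rewrite ev eN eN1 evk; apply.
    move=> [s s0 Hs] HQ.
    have pos (e1 : seq R) : 0 < (set_nth 0 e1 N s)`_N by rewrite nth_set_nth /= eqxx.
    pose e2 := set_nth 0 (set_nth 0 [::] N.+1 y) N s.
    have E2 j : e2`_j = if j == N then s else (set_nth 0 [::] N.+1 y)`_j.
      by rewrite /e2 nth_set_nth.
    have eN : e2`_N = s by rewrite E2 eqxx.
    have eN1 : e2`_N.+1 = y by rewrite E2 gtn_eqF // nth_set_nth /= eqxx.
    apply: (HQ e2); first by move=> j; rewrite inE E2 => /negPf->.
    split=> [|e'' He'']; first exact: pos.
    have HN j : (N <= j)%N -> e''`_j = e2`_j.
      by move=> leNj; apply: He''; rewrite mem_iota /= add0n -leqNgt.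
    have -> : e''`_N = s by rewrite HN.
    have := HN N.+1 (leqnSn N); rewrite eN1 => -> Pe.
    exact: (Hs (fun i => e''`_i)).
  have [||c [c1 c2]] := @definable_lub R Q [::] N.+1 defQ.
  - exists (- B); apply/QS; exists 1 => // v /(HB _ _ k).
    by rewrite ler_norml => /andP[].
  - exists B => y /QS[s s0 Hs]; have [v Pv] := ne s s0.
    by apply: le_trans (Hs v Pv) _; have := HB v s k Pv; rewrite ler_norml => /andP[].
  exists c; split=> [y /QS/c1 //|y /c2[z /QS Sz ltyz]]; by exists z.
exists c => s s0.
have [|z [s1 s10 Hs1] ltz] := c2 (c - s); first by lra.
pose s2 := Order.min s s1.
have s20 : 0 < s2 by rewrite lt_min s0.
(* Otherwise [c + s] would be an eventual lower bound exceeding the supremum [c]. *)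
have [v Pv ltv] : exists2 v, P v s2 & v k < c + s.
  apply: NNPP => H; have : S (c + s).
    exists s2 => // v Pv; rewrite leNgt; apply/negP => lt; apply: H; by exists v.
  by move/c1; lra.
exists v; split; first by apply: mono Pv; rewrite ge_min lexx.
have := Hs1 v (mono _ _ _ _ Pv); rewrite ge_min lexx orbT => /(_ isT) lez.
by rewrite ler_norml; apply/andP; split; lra.
Qed.

(* A nested definable family of nonempty sets in a fixed box has a common limit point;
   this replaces sequential compactness, which fails over a general real closed field. *)
Lemma nested_limit N (P : ('I_N -> R) -> R -> Prop) :
  definable_family P ->
  (forall s, 0 < s -> exists v, P v s) ->
  (forall v s s', s <= s' -> P v s -> P v s') ->
  (exists B, forall v s i, P v s -> `|v i| <= B) ->
  exists c : 'I_N -> R, forall s, 0 < s -> exists v, P v s /\ forall i, `|v i - c i| <= s.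
Proof.
move=> defP ne mono bd.
suff [c Hc] : exists c : 'I_N -> R, forall s, 0 < s ->
    exists v, P v s /\ forall i, i \in enum 'I_N -> `|v i - c i| <= s.
  by exists c => s /Hc[v [Pv Hv]]; exists v; split=> // i; apply: Hv; rewrite mem_enum.
elim: (enum 'I_N) P defP ne mono bd => [|k l IH] P defP ne mono bd.
  by exists (fun=> 0) => s /ne[v Pv]; exists v.
have [ck Hck] := nested_coordinate k defP ne mono bd.
(* Coordinates are fixed one at a time: closeness to [ck] joins the family, which stays definable,
   nested and nonempty. *)
have [||||c Hc] := IH (fun v s => P v s /\ `|v k - ck| <= s).
- apply: definable_and => //.
  have [f Hf] : definable (fun e : seq R => - e`_N <= e`_k - ck /\ e`_k - ck <= e`_N).
    have t1 : is_term_fun (fun e : seq R => e`_k - ck).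
      by apply: term_fun_add; [apply: term_fun_var|apply: term_fun_const].
    apply: definable_and; apply: definable_le => //; last exact: term_fun_var.
    exact/term_fun_opp/term_fun_var.
  by exists f => e; rewrite -Hf ler_norml; split=> /andP.
- exact: Hck.
- by move=> v s s' le [/(mono _ _ _ le) ? ?]; split=> //; apply: le_trans le.
- by have [B HB] := bd; exists B => v s i [/HB].
exists (fun i => if i == k then ck else c i) => s /Hc[v [[Pv Hk] Hv]].
exists v; split=> // i; rewrite inE; case: eqP => [->//|_ /=]; exact: Hv.
Qed.

End DefinableClosure.

(** * Polynomial functions *)

Lemma mpoly_ring_ind N (R : comNzRingType) (P : {mpoly R[N]} -> Prop) :
  (forall c, P c%:MP) -> (forall i, P 'X_i) ->
  (forall p q, P p -> P q -> P (p + q)) -> (forall p q, P p -> P q -> P (p * q)) ->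
  forall p, P p.
Proof.
move=> PC PX PD PM p.
have PXn i k : P ('X_i ^+ k).
  elim: k => [|k IH]; first by rewrite expr0 -mpolyC1; apply: PC.
  by rewrite exprS; apply: PM.
rewrite [p]mpolyE; apply: (big_ind P) => [|//|m _]; first by rewrite -mpolyC0; apply: PC.
rewrite -mul_mpolyC; apply: (PM) => //.
rewrite mpolyXE_id; apply: (big_ind P) => [|//|i _ //].
by rewrite -mpolyC1; apply: PC.
Qed.

(** * Total degree bounds *)

Section DegreeBound.
Variables (N : nat) (R : comNzRingType).
Implicit Types p q : {mpoly R[N]}.

Definition mdeg_le d p := forall m, m \in msupp p -> (mdeg m <= d)%N.

Lemma mdeg_leW d d' p : (d <= d')%N -> mdeg_le d p -> mdeg_le d' p.
Proof. by move=> le H m /H /leq_trans; apply. Qed.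

Lemma mdeg_leC d c : mdeg_le d c%:MP.
Proof.
move=> m; rewrite mcoeff_msupp mcoeffC; case: (eqVneq m 0%MM) => [->|_]; last by rewrite mulr0 eqxx.
by rewrite mdeg0.
Qed.

Lemma mdeg_leX m : mdeg_le (mdeg m) 'X_[m].
Proof. by move=> m'; rewrite msuppX inE => /eqP->. Qed.

Lemma mdeg_leD d p q : mdeg_le d p -> mdeg_le d q -> mdeg_le d (p + q).
Proof.
by move=> Hp Hq m /msuppD_le; rewrite mem_cat => /orP[/Hp|/Hq].
Qed.

Lemma mdeg_leN d p : mdeg_le d p -> mdeg_le d (- p).
Proof. by move=> Hp m; rewrite (perm_mem (msuppN p)) => /Hp. Qed.

Lemma mdeg_leZ d c p : mdeg_le d p -> mdeg_le d (c *: p).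
Proof. by move=> Hp m /msuppZ_le/Hp. Qed.

Lemma mdeg_leM d d' p q : mdeg_le d p -> mdeg_le d' q -> mdeg_le (d + d') (p * q).
Proof.
move=> Hp Hq m /msuppM_le/allpairsP[[m1 m2] /= [/Hp H1 /Hq H2 ->]].
by rewrite mdegD leq_add.
Qed.

Lemma mdeg_le_sum d (I : Type) (r : seq I) (P : pred I) (F : I -> {mpoly R[N]}) :
  (forall i, P i -> mdeg_le d (F i)) -> mdeg_le d (\sum_(i <- r | P i) F i).
Proof.
move=> HF; apply: (big_ind (mdeg_le d)) => //; last by move=> p q; apply: mdeg_leD.
by rewrite -mpolyC0; apply: mdeg_leC.
Qed.

Lemma mdeg_le_prod d (I : finType) (F : I -> {mpoly R[N]}) :
  (forall i, mdeg_le d (F i)) -> mdeg_le (#|I| * d) (\prod_i F i).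
Proof.
move=> HF; rewrite -sum_nat_const.
apply: (big_ind2 (fun p k => mdeg_le k p)) => //; first by rewrite -mpolyC1; apply: mdeg_leC.
by move=> p k q l; apply: mdeg_leM.
Qed.

Lemma mdeg_le_mderiv d i p : mdeg_le d p -> mdeg_le d p^`M(i).
Proof.
move=> Hp m; rewrite mcoeff_msupp mcoeff_mderiv => H.
have : (m + U_(i))%MM \in msupp p.
  by rewrite mcoeff_msupp; apply: contraNneq H => ->; rewrite mul0rn.
by move/Hp; rewrite mdegD; apply: leq_trans; rewrite leq_addr.
Qed.

End DegreeBound.

(** * Continuity and local maxima of polynomial functions *)

Section MpolyAnalysis.
Variables (R : rcfType) (N : nat).
Implicit Types (p q G : {mpoly R[N]}) (v c : 'I_N -> R).

Lemma meval_bound p d B v : mdeg_le d p -> 1 <= B -> (forall i, `|v i| <= B) ->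
  `|p.@[v]| <= (\sum_(m <- msupp p) `|p@_m|) * B ^+ d.
Proof.
move=> Hd B1 Hv; rewrite mevalE mulr_suml.
apply: le_trans (ler_norm_sum _ _ _) _; rewrite big_seq [leRHS]big_seq.
apply: ler_sum => m Hm; rewrite normrM ler_wpM2l //.
have B0 : 0 <= B by lra.
have Hmd := Hd _ Hm.
apply: (@le_trans _ _ (B ^+ mdeg m)); last by rewrite ler_weXn2l.
rewrite mdegE -prodrXr normr_prod.
apply: ler_prod => i _; rewrite normrX exprn_ge0 //=.
by rewrite lerXn2r ?nnegrE.
Qed.

Lemma meval_continuous p c eta : 0 < eta ->
  exists2 delta, 0 < delta &
    forall v, (forall i, `|v i - c i| <= delta) -> `|p.@[v] - p.@[c]| < eta.
Proof.
elim/mpoly_ring_ind: p eta => [a|i|p q IHp IHq|p q IHp IHq] eta eta0.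
- by exists 1 => // v _; rewrite !mevalC subrr normr0.
- exists (eta / 2) => [|v Hv]; first lra.
  by rewrite !mevalXU; apply: le_lt_trans (Hv i) _; lra.
- have [|d1 d10 H1] := IHp (eta / 2); first lra.
  have [|d2 d20 H2] := IHq (eta / 2); first lra.
  exists (Order.min d1 d2) => [|v Hv]; first by rewrite lt_min d10.
  have {}H1 : `|p.@[v] - p.@[c]| < eta / 2.
    by apply: H1 => i; apply: le_trans (Hv i) _; rewrite ge_min lexx.
  have {}H2 : `|q.@[v] - q.@[c]| < eta / 2.
    by apply: H2 => i; apply: le_trans (Hv i) _; rewrite ge_min lexx orbT.
  by rewrite !mevalD; move: H1 H2; rewrite !ltr_norml => /andP[? ?] /andP[? ?]; apply/andP; split; lra.
set a := `|p.@[c]|; set b := `|q.@[c]|.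
have a0 : 0 <= a by exact: normr_ge0.
have b0 : 0 <= b by exact: normr_ge0.
(* The error of the product is below [e * e + a * e + b * e], and [e <= 1] bounds this by
   [e * (1 + a + b) <= eta]. *)
pose e := Order.min 1 (eta / (1 + a + b)).
have e0 : 0 < e by rewrite lt_min ltr01 divr_gt0 //; lra.
have e1 : e <= 1 by rewrite ge_min lexx.
have e2 : e * (1 + a + b) <= eta.
  rewrite -ler_pdivlMr; last lra.
  by rewrite ge_min lexx orbT.
have [d1 d10 H1] := IHp e e0; have [d2 d20 H2] := IHq e e0.
exists (Order.min d1 d2) => [|v Hv]; first by rewrite lt_min d10.
have {}H1 : `|p.@[v] - p.@[c]| < e.
  by apply: H1 => i; apply: le_trans (Hv i) _; rewrite ge_min lexx.
have {}H2 : `|q.@[v] - q.@[c]| < e.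
  by apply: H2 => i; apply: le_trans (Hv i) _; rewrite ge_min lexx orbT.
rewrite !mevalM.
have -> : p.@[v] * q.@[v] - p.@[c] * q.@[c] =
  (p.@[v] - p.@[c]) * (q.@[v] - q.@[c]) + (p.@[c] * (q.@[v] - q.@[c]) + q.@[c] * (p.@[v] - p.@[c])) by ring.
apply: lt_le_trans e2.
apply: le_lt_trans (ler_normD _ _) _.
apply: (@le_lt_trans _ _ (`|p.@[v] - p.@[c]| * `|q.@[v] - q.@[c]| + (a * `|q.@[v] - q.@[c]| + b * `|p.@[v] - p.@[c]|))).
  by rewrite normrM lerD2l; apply: le_trans (ler_normD _ _) _; rewrite !normrM.
set x := `|p.@[v] - _|; set y := `|q.@[v] - _|; rewrite -/x in H1; rewrite -/y in H2.
have x0 : 0 <= x by exact: normr_ge0.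
have y0 : 0 <= y by exact: normr_ge0.
nra.
Qed.

Lemma meval_taylor p c i :
  exists q : {poly R}, forall t,
    p.@[fun j => c j + (j == i)%:R * t] = p.@[c] + t * (p^`M(i)).@[c] + t ^+ 2 * q.[t].
Proof.
elim/mpoly_ring_ind: p => [a|j|p q [p' Hp] [q' Hq]|p q [p' Hp] [q' Hq]].
- by exists 0 => t; rewrite !mevalC mderivC meval0 horner0 !mulr0 !addr0.
- exists 0 => t; rewrite !mevalXU mderivX mevalZ mnm1E horner0.
  case: eqP => [->|_]; last by rewrite !mul0r !mulr0 !addr0.
  by rewrite mevalX big1 => [|k _]; [rewrite mul1r mulr0 addr0 !mulr1|rewrite mnmBE subnn expr0].
- by exists (p' + q') => t; rewrite !mevalD mderivD mevalD Hp Hq hornerD; ring.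
pose a := p.@[c]; pose b := q.@[c]; pose a' := p^`M(i).@[c]; pose b' := q^`M(i).@[c].
exists ((a' * b')%:P + a *: q' + b *: p' + 'X * (a' *: q' + b' *: p') + 'X ^+ 2 * p' * q') => t.
by rewrite !mevalM mderivM mevalD !mevalM Hp Hq !hornerE /a /b /a' /b'; ring.
Qed.

(** If the derivative were nonzero, a small step along axis [i] in the direction of its sign would
    increase [G], the quadratic remainder being dominated. *)
Lemma mderiv_local_max G c delta i : 0 < delta ->
  (forall v, (forall j, `|v j - c j| <= delta) -> G.@[v] <= G.@[c]) -> (G^`M(i)).@[c] = 0.
Proof.
move=> d0 Hmax; have [q Hq] := meval_taylor G c i.
set g := (G^`M(i)).@[c] in Hq *.
have Hle t : `|t| <= delta -> t * (g + t * q.[t]) <= 0.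
  move=> Ht; have := Hmax (fun j => c j + (j == i)%:R * t); rewrite Hq.
  have -> : t * (g + t * q.[t]) = t * g + t ^+ 2 * q.[t] by ring.
  suff H j : `|c j + (j == i)%:R * t - c j| <= delta by move=> /(_ H); lra.
  by rewrite addrAC subrr add0r; case: (j == i); rewrite ?mul1r ?mul0r ?normr0 // ltW.
apply/eqP/negPn/negP => g0.
have Hg : 0 < `|g| / 2 by rewrite divr_gt0 ?normr_gt0.
have [B B0 HB] : exists2 B, 0 < B & forall t, `|t| <= delta -> `|q.[t]| <= B.
  exists (1 + \sum_(k < size q) `|q`_k| * delta ^+ k) => [|t Ht].
    by rewrite ltr_wpDr // sumr_ge0 // => k _; rewrite mulr_ge0 // exprn_ge0 // ltW.
  rewrite horner_coef; apply: le_trans (ler_norm_sum _ _ _) _.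
  rewrite ler_wpDl //; apply: ler_sum => k _; rewrite normrM ler_wpM2l //.
  by rewrite normrX lerXn2r ?nnegrE // ltW.
(* With this step length the remainder is at most half of the linear term. *)
pose e := Order.min delta (`|g| / 2 / B).
have e0 : 0 < e by rewrite lt_min d0 divr_gt0.
have ed : e <= delta by rewrite ge_min lexx.
have eB : e * B <= `|g| / 2 by rewrite -ler_pdivlMr // ge_min lexx orbT.
pose t := Num.sg g * e.
have tn : `|t| = e by rewrite normrM normr_sg g0 mul1r gtr0_norm.
have := Hle t; rewrite tn => /(_ ed).
have := HB t; rewrite tn => /(_ ed); rewrite ler_norml => /andP[q1 q2].
move: q1 q2; have {tn} : t = e /\ 0 < g \/ t = - e /\ g < 0.
  by rewrite /t; case: sgrP g0 => //; rewrite ?eqxx // ?mul1r ?mulN1r; auto.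
case=> [] [-> Hs] q1 q2.
  rewrite gtr0_norm // in eB Hg; rewrite pmulr_rle0 // => Hg'.
  have : 0 <= e * (q.[e] + B) by apply: mulr_ge0; lra.
  nra.
rewrite ltr0_norm // in eB Hg; rewrite mulNr oppr_le0 pmulr_rge0 // => Hg'.
have : 0 <= e * (q.[- e] + B) by apply: mulr_ge0; lra.
nra.
Qed.

End MpolyAnalysis.

(** * Existence of a critical point in a sign region *)

Section InteriorMax.
Variables (R : rcfType) (N : nat) (J : finType).
Variables (h : J -> {mpoly R[N]}) (G : {mpoly R[N]}) (a : 'I_N -> R) (B : R).
Hypothesis ha : forall j, 0 < (h j).@[a].
Hypothesis Ga : 0 < G.@[a].
Hypothesis GB : forall v i, 0 <= G.@[v] -> `|v i| <= B.
Hypothesis Gh : forall v j, 0 < G.@[v] -> (h j).@[v] != 0.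

(** A maximum of [G] over the closed region [V] has value at least [G.@[a] > 0], so no [h j]
    vanishes there; the maximum is interior and hence critical. *)
Lemma interior_critical_point :
  exists c, (forall j, 0 < (h j).@[c]) /\ (forall i, (G^`M(i)).@[c] = 0).
Proof.
pose V v := forall j, j \in enum J -> 0 <= (h j).@[v].
have defV : definable (fun e : seq R => V (fun i : 'I_N => e`_i)).
  apply: definable_all => j; apply: definable_le; first exact: term_fun_const.
  exact: term_fun_meval.
have Va : V a by move=> j _; exact: ltW.
have [c0 [c01 c02]] : exists c0, is_lub (fun t => exists v, V v /\ t <= G.@[v]) c0.
  apply: (@family_lub R N (fun v t => V v /\ t <= G.@[v])).
  - apply: definable_and => //; apply: definable_le; first exact: term_fun_var.
    exact: term_fun_meval.
  - by exists G.@[a]; exists a.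
  - exists ((\sum_(m <- msupp G) `|G@_m|) * (Order.max 1 B) ^+ (msize G)) => t v [_ le].
    have S0 : 0 <= \sum_(m <- msupp G) `|G@_m| by apply: sumr_ge0.
    have M0 : 0 <= Order.max 1 B by rewrite le_max ler01.
    have [neg|pos] := ltP G.@[v] 0.
      by apply: le_trans (le_trans le (ltW neg)) _; rewrite mulr_ge0 // exprn_ge0.
    apply: le_trans le (le_trans (ler_norm _) _); apply: meval_bound => //.
      by move=> m /msize_mdeg_lt/ltnW.
      by rewrite le_max lexx.
    by move=> i; rewrite le_max GB ?orbT.
have c0a : G.@[a] <= c0 by apply: c01; exists a.
have Vc0 v : V v -> G.@[v] <= c0 by move=> Vv; apply: c01; exists v.
(* The family consists of the [s]-approximate maximisers; the condition [0 <= G.@[v]] keeps them in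
   the box of radius [B]. *)
have [||||c Hc] := @nested_limit R N (fun v s => V v /\ 0 <= G.@[v] /\ c0 - s <= G.@[v]).
- apply: definable_and => //; apply: definable_and.
    by apply: definable_le; [apply: term_fun_const|apply: term_fun_meval].
  apply: definable_le; last exact: term_fun_meval.
  by apply: term_fun_add; [apply: term_fun_const|apply/term_fun_opp/term_fun_var].
- move=> s s0; have [|z [v [Vv le]] lt] := c02 (Order.max 0 (c0 - s)).
    by rewrite gt_max (lt_le_trans Ga c0a); lra.
  by exists v; move: lt; rewrite gt_max => /andP[? ?]; do 2?split=> //; lra.
- by move=> v s s' le [Vv [? ?]]; do 2?split=> //; lra.
- by exists B => v s i [_ [/GB]].
have Vc j : 0 <= (h j).@[c].
  rewrite leNgt; apply/negP => neg.
  have [|d d0 Hd] := meval_continuous (h j) c (eta := - (h j).@[c]); first lra.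
  have [v [[Vv _] /Hd]] := Hc d d0.
  by have := Vv j; rewrite mem_enum => /(_ isT) pos; rewrite ltr_norml => /andP[]; lra.
have Gc : c0 <= G.@[c].
  rewrite leNgt; apply/negP => neg; pose eta := (c0 - G.@[c]) / 2.
  have eta0 : 0 < eta by rewrite /eta; lra.
  have eta2 : eta * 2 = c0 - G.@[c] by rewrite /eta; lra.
  have [d d0 Hd] := meval_continuous G c eta0.
  have [|v [[_ [_ Hv]] Hvc]] := Hc (Order.min d eta); first by rewrite lt_min d0.
  have : `|G.@[v] - G.@[c]| < eta.
    by apply: Hd => i; apply: le_trans (Hvc i) _; rewrite ge_min lexx.
  have : Order.min d eta <= eta by rewrite ge_min lexx orbT.
  by clearbody eta; rewrite ltr_norml => ? /andP[]; lra.
have hc j : 0 < (h j).@[c].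
  by rewrite lt_def Gh ?Vc ?(lt_le_trans Ga (le_trans c0a Gc)).
have [d d0 Hd] : exists2 d, 0 < d & forall v, (forall i, `|v i - c i| <= d) -> V v.
  rewrite /V; elim: (enum J) => [|j l [d d0 Hd]]; first by exists 1.
  have [d1 d10 Hd1] := meval_continuous (h j) c (hc j).
  exists (Order.min d d1) => [|v Hv k]; first by rewrite lt_min d0.
  rewrite inE => /orP[/eqP->|Hk].
    have : `|(h j).@[v] - (h j).@[c]| < (h j).@[c].
      by apply: Hd1 => i; apply: le_trans (Hv i) _; rewrite ge_min lexx orbT.
    by rewrite ltr_norml => /andP[]; lra.
  by apply: Hd Hk => i; apply: le_trans (Hv i) _; rewrite ge_min lexx.
exists c; split=> // i; refine (@mderiv_local_max R N G c d i d0 _) => v /Hd/Vc0 le; exact: le_trans le Gc.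
Qed.

End InteriorMax.

(** * Sign patterns *)

(* A system [x_i ^ e = g_i(x)] with [deg g_i < e] lets one reduce every monomial, as a function
   on the solutions, to exponents below [e]; the reduced monomials thus span all functions on
   the solutions, which bounds their number without Bezout's theorem. *)
Lemma power_system_card (F : fieldType) N e K (g : 'I_N -> {mpoly F[N]}) (w : 'I_K -> 'I_N -> F) :
  (forall i, mdeg_le e (g i)) ->
  (forall k i, w k i ^+ e.+1 = (g i).@[w k]) ->
  (forall k l, k != l -> exists i, w k i != w l i) ->
  (K <= e.+1 ^ N)%N.
Proof.
move=> Hg Hw Hd.
pose A : finType := {ffun 'I_N -> 'I_e.+1}.
(* The rows are the reduced monomials as functions on the [K] solutions. Showing that they span all
   such functions gives [K <= #|A|]. *)
pose M : 'M[F]_(#|A|, K) := \matrix_(a, k) \prod_i w k i ^+ ((enum_val a : {ffun 'I_N -> 'I_e.+1}) i).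
pose ev (p : {mpoly F[N]}) : 'rV[F]_K := \row_k p.@[w k].
have HX n m : (mdeg m < n)%N -> (ev 'X_[m] <= M)%MS.
  elim: n m => // n IH m Hm.
  (* If some exponent exceeds [e], replacing [x_i ^ e.+1] by [g i], of degree at most [e], lowers
     the total degree. *)
  case: (pickP (fun i => (e < m i)%N)) => [i Hi|Hsmall].
    have Em : m = (m - U_(i) *+ e.+1 + U_(i) *+ e.+1)%MM.
      rewrite submK //; apply/mnm_lepP => j; rewrite mulmnE mnm1E.
      by case: eqP => [<-|_]; rewrite ?mul1n ?mul0n.
    set m' := (m - _)%MM in Em.
    have -> : ev 'X_[m] = \sum_(k <- msupp (g i)) (g i)@_k *: ev 'X_[m' + k].
      apply/rowP => k; rewrite mxE summxE Em mpolyXD mevalM -mpolyXn rmorphXn /= mevalXU Hw.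
      rewrite [X in _ * X.@[_]]mpolyE raddf_sum mulr_sumr; apply: eq_bigr => l _.
      by rewrite !mxE mpolyXD mevalM /= mevalZ mulrCA.
    rewrite big_seq; apply: summx_sub => k Hk; apply: scalemx_sub; apply: IH.
    have := Hg i k Hk; move: Hm; rewrite Em !mdegD mdegMn mdeg1; lia.
  pose a : A := [ffun i => inord (m i)].
  have -> : ev 'X_[m] = row (enum_rank a) M.
    apply/rowP => k; rewrite !mxE mevalX; apply: eq_bigr => i _.
    by rewrite enum_rankK ffunE inordK // ltnS leqNgt Hsmall.
  exact: row_sub.
have Hp p : (ev p <= M)%MS.
  have -> : ev p = \sum_(m <- msupp p) p@_m *: ev 'X_[m].
    apply/rowP => k; rewrite mxE {1}[p]mpolyE raddf_sum summxE; apply: eq_bigr => m _.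
    by rewrite !mxE /= mevalZ.
  by apply: summx_sub => m _; apply: scalemx_sub; apply: (HX (mdeg m).+1).
have Hfull : row_full M.
  rewrite -sub1mx; apply/row_subP => k.
  (* Lagrange interpolation: the product of the [p l] is 1 at [w k] and 0 at every other
     solution. *)
  have [p Hpk] : exists p : 'I_K -> {mpoly F[N]},
      forall l, (l != k -> (p l).@[w l] = 0) /\ (p l).@[w k] = 1.
    apply: (fin_all_exists (P := fun l p => (l != k -> p.@[w l] = 0) /\ p.@[w k] = 1)) => l.
    case: (eqVneq l k) => [->|/Hd[i Hi]]; first by exists 1; rewrite meval1.
    exists ((w k i - w l i)^-1 *: ('X_i - (w l i)%:MP)).
    rewrite !mevalZ !mevalB !mevalXU !mevalC subrr mulr0; split=> //.
    by rewrite mulVf // subr_eq0 eq_sym.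
  have -> : row k 1%:M = ev (\prod_l p l).
    apply/rowP => l; rewrite !mxE rmorph_prod /=; case: (eqVneq k l) => [<-|nkl].
      by rewrite big1 // => l' _; have [_ ->] := Hpk l'.
    by rewrite (bigD1 l) //=; have [-> //] := Hpk l; rewrite ?mul0r // eq_sym.
  exact: Hp.
by move: Hfull; rewrite /row_full => /eqP <-; rewrite (leq_trans (rank_leq_row _)) // card_ffun !card_ord.
Qed.

Section SignPatterns.
Variables (R : rcfType) (N : nat).

Definition power_sum k : {mpoly R[N]} := \sum_i 'X_i ^+ k.

Lemma power_sumE k v : (power_sum k).@[v] = \sum_i v i ^+ k.
Proof.
by rewrite raddf_sum /=; apply: eq_bigr => i _; rewrite rmorphXn /= mevalXU.
Qed.

Lemma mderiv_power_sum k v i : ((power_sum k.+1)^`M(i)).@[v] = k.+1%:R * v i ^+ k.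
Proof.
rewrite /power_sum (big_morph _ (mderivD i) (mderiv0 R i)) (big_morph _ (mevalD v) (meval0 v)) (bigD1 i) //= big1 ?addr0 => [|j nji]; rewrite mpolyXn mderivX mevalZ mulmnE mnm1E.
  by rewrite eqxx mul1n mulmS addmC addmK -mpolyXn rmorphXn /= mevalXU.
by rewrite (negPf nji) mul0n mul0r.
Qed.

(** If the largest absolute coordinate [M] exceeds [1 + C / eps], then [F] is at most
    [C * M ^ d.*2 < eps * M ^ d.*2.+2], and the even power sum is at least [M ^ d.*2.+2]. *)
Lemma coercive_sub d (eps : R) (F : {mpoly R[N]}) :
  mdeg_le d.*2 F -> 0 < eps ->
  exists B, forall v i, 0 <= (F - eps *: power_sum d.*2.+2).@[v] -> `|v i| <= B.
Proof.
move=> HF eps0; pose C : R := \sum_(m <- msupp F) `|F@_m|.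
have C0 : 0 <= C by apply: sumr_ge0.
exists (1 + C / eps) => v i; rewrite mevalB mevalZ power_sumE => Hpos.
rewrite leNgt; apply/negP => Hi.
have [i0 Hi0] : exists i0, forall j, `|v j| <= `|v i0|.
  by exists [arg max_(j > i) `|v j|]%O; case: arg_maxP => // i0 _ H j; apply: H.
set M := `|v i0| in Hi0.
have HM : 1 + C / eps < M by apply: lt_le_trans Hi (Hi0 i).
have Ce : 0 <= C / eps by rewrite divr_ge0 // ltW.
have M1 : 1 <= M by lra.
have CM : C < eps * M ^+ 2.
  have : C / eps < M by lra.
  by rewrite ltr_pdivrMr // expr2; nra.
have Mk : 0 < M ^+ d.*2 by rewrite exprn_gt0 //; lra.
have F1 : `|F.@[v]| <= C * M ^+ d.*2 by apply: meval_bound.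
have S1 : M ^+ d.*2.+2 <= \sum_j v j ^+ d.*2.+2.
  rewrite (bigD1 i0) //= -doubleS -!muln2 !(mulnC _ 2%N) !exprM real_normK ?num_real //.
  by rewrite lerDl sumr_ge0 // => j _; rewrite exprM exprn_ge0 // sqr_ge0.
have S2 : C * M ^+ d.*2 < eps * \sum_j v j ^+ d.*2.+2.
  apply: (@lt_le_trans _ _ (eps * M ^+ d.*2.+2)); last by rewrite ler_wpM2l // ltW.
  by rewrite -addn2 addnC exprD mulrA ltr_pM2r.
have := ler_norm F.@[v]; lra.
Qed.

Lemma common_small (T : eqType) (l : seq T) (x y : T -> R) :
  (forall t, t \in l -> 0 < x t) -> (forall t, 0 <= y t) ->
  exists2 eps, 0 < eps & forall t, t \in l -> eps * y t < x t.
Proof.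
move=> Hx Hy; elim: l Hx => [|t l IH] Hx; first by exists 1.
have [|e e0 He] := IH; first by move=> u ul; apply: Hx; rewrite inE ul orbT.
have xt : 0 < x t by apply: Hx; rewrite mem_head.
have yt := Hy t.
exists (Order.min e (x t / (1 + y t))).
  by rewrite lt_min e0 divr_gt0 //; lra.
move=> u; rewrite inE => /orP[/eqP->|ul].
  apply: (@le_lt_trans _ _ (x t / (1 + y t) * y t)).
    by rewrite ler_wpM2r // ge_min lexx orbT.
  by rewrite mulrAC ltr_pdivrMr; nra.
apply: le_lt_trans (He u ul); by rewrite ler_wpM2r // ge_min lexx.
Qed.

Definition signed (b : bool) (p : {mpoly R[N]}) := if b then p else - p.

(* [F = prod f_j ^ 2] vanishes exactly on the walls between sign regions, so the maximum of
   [F - eps * sum x_i ^ (2 d |J| + 2)] on a region is a critical point inside it. *)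
Theorem sign_pattern_card (J : finType) (f : J -> {mpoly R[N]}) d (A : {set {ffun J -> bool}}) :
  (forall j, mdeg_le d (f j)) ->
  (forall sigma, sigma \in A -> exists v, forall j, 0 < (signed (sigma j) (f j)).@[v]) ->
  (#|A| <= (#|J| * d).*2.+1 ^ N)%N.
Proof.
move=> Hf HA; pose e := (#|J| * d)%N.
have [a Ha] : exists a : {ffun J -> bool} -> 'I_N -> R, forall s, s \in A ->
    forall j, 0 < (signed (s j) (f j)).@[a s].
  apply: (fin_all_exists (P := fun s v => s \in A -> forall j, 0 < (signed (s j) (f j)).@[v])) => s.
  by have [/HA[v Hv]|_] := boolP (s \in A); [exists v|exists (fun=> 0)].
pose F := \prod_j f j ^+ 2.
have FE v : F.@[v] = \prod_j (f j).@[v] ^+ 2.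
  by rewrite rmorph_prod; apply: eq_bigr => j _; rewrite rmorphXn.
have degF : mdeg_le e.*2 F.
  by rewrite -mul2n mulnCA; apply: mdeg_le_prod => j; rewrite mul2n -addnn expr2; apply: mdeg_leM.
have signed_neq0 s j v : (signed (s j) (f j)).@[v] != 0 = ((f j).@[v] != 0).
  by rewrite /signed; case: (s j); rewrite ?mevalN ?oppr_eq0.
have Fa s : s \in A -> 0 < F.@[a s].
  move=> sA; rewrite FE prodr_gt0 // => j _; rewrite lt_def sqr_ge0 andbT expf_neq0 //.
  by rewrite -(signed_neq0 s) gt_eqF // Ha.
have psum_ge0 v : 0 <= (power_sum e.*2.+2).@[v].
  rewrite power_sumE sumr_ge0 // => i _.
  by rewrite -doubleS -mul2n exprM exprn_ge0 // sqr_ge0.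
(* A single [eps] serves all patterns, so that all the critical points solve one and the same
   system. *)
have [||eps eps0 Heps] := @common_small _ (enum A) (fun s => F.@[a s])
  (fun s => (power_sum e.*2.+2).@[a s]) => [s|s|]; rewrite ?mem_enum //.
  exact: Fa.
pose G := F - eps *: power_sum e.*2.+2.
have [B HB] := coercive_sub degF eps0.
have [c Hc] : exists c : 'I_#|A| -> 'I_N -> R, forall k,
    (forall j, 0 < (signed ((enum_val k : {ffun J -> bool}) j) (f j)).@[c k]) /\
    forall i, (G^`M(i)).@[c k] = 0.
  apply: (@fin_all_exists 'I_#|A| (fun=> 'I_N -> R) (fun k v =>
    (forall j, 0 < (signed ((enum_val k : {ffun J -> bool}) j) (f j)).@[v]) /\
    forall i, (G^`M(i)).@[v] = 0)) => k.
  have kA : enum_val k \in A by apply: enum_valP.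
  apply: (@interior_critical_point R N J _ G (a (enum_val k)) B).
  - exact: Ha.
  - by rewrite mevalB mevalZ subr_gt0 Heps // mem_enum.
  - exact: HB.
  - move=> v j HG; rewrite signed_neq0; apply: contraTneq HG => f0.
    rewrite -leNgt mevalB mevalZ FE (bigD1 j) //= f0 expr0n mul0r sub0r oppr_le0.
    by rewrite mulr_ge0 // ltW.
have Hn : eps * e.*2.+2%:R != 0 by rewrite mulf_neq0 ?gt_eqF // ltr0n.
(* Dividing the critical equations by [eps * e.*2.+2%:R] isolates [x_i ^ e.*2.+1]; the other side
   has degree at most [e.*2]. *)
apply: (@power_system_card R N e.*2 #|A| (fun i => (eps * e.*2.+2%:R)^-1 *: F^`M(i)) c).
- by move=> i; apply: mdeg_leZ; apply: mdeg_le_mderiv.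
- move=> k i; have [_ /(_ i)] := Hc k.
  rewrite mderivB mderivZ mevalB !mevalZ mderiv_power_sum mulrA => /eqP.
  by rewrite subr_eq0 => /eqP->; rewrite mulKf.
move=> k l nkl.
have [j Hj] : exists j, (enum_val k : {ffun J -> bool}) j != (enum_val l : {ffun J -> bool}) j.
  apply: NNPP => H; move/eqP: nkl; apply; apply: enum_val_inj; apply/ffunP => j.
  by apply/eqP/negPn/negP => Hj; apply: H; exists j.
apply: NNPP => H; have Ec : c k = c l.
  by apply: functional_extensionality => i; apply/eqP/negPn/negP => Hi; apply: H; exists i.
have [/(_ j) h1 _] := Hc k; have [/(_ j) h2 _] := Hc l.
move: h1 h2 Hj; rewrite Ec /signed.
by case: (enum_val k j); case: (enum_val l j) => //; rewrite mevalN; lra.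
Qed.

End SignPatterns.

(** * The upper bound *)

Section UpperBound.
Variables (R : rcfType) (n : nat).
Implicit Types (M : 'M[R]_n) (q : 'cV[R]_n) (B : {set 'I_n}).

(** A kernel vector vanishes on [B], where the rows see minus an invertible principal submatrix
    besides zeros, and then off [B], where the columns are unit vectors. *)
Lemma A_mat_unit M B : P_matrix M -> A_mat M B \in unitmx.
Proof.
move=> PM; rewrite unitmxE unitfE -det_tr; apply/det0P => -[v /eqP v0 Hv].
have HA i : \sum_j v 0 j * A_mat M B i j = 0.
  have /rowP/(_ i) := Hv; rewrite !mxE => H; rewrite -[RHS]H.
  by apply: eq_bigr => j _; rewrite (mxE _ (fun i j => A_mat M B j i)).
have vB j : j \in B -> v 0 j = 0.
  pose u : 'rV[R]_#|B| := \row_k v 0 (enum_val k).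
  suff u0 : u = 0.
    move=> jB; have /rowP/(_ (enum_rank_in jB j)) := u0.
    by rewrite !mxE enum_rankK_in.
  have : principal_submx M B \in unitmx by rewrite unitmxE unitfE gt_eqF.
  rewrite -unitmx_tr => Hu; apply: (can_inj (mulmxK Hu)); rewrite mul0mx.
  apply/rowP => k; rewrite !mxE; have := HA (enum_val k).
  rewrite (bigID (mem B)) /= [X in _ + X]big1 => [|j' /negPf jB]; last first.
    rewrite mxE jB; case: eqP => [E|_]; last by rewrite mulr0.
    by rewrite -E enum_valP in jB.
  rewrite addr0 big_enum_val => H; rewrite -[RHS]oppr0 -[in RHS]H -sumrN.
  by apply: eq_bigr => l _; rewrite !mxE enum_valP mulrN opprK.
apply: v0; apply/rowP => j; rewrite [RHS]mxE; have [/vB //|nB] := boolP (j \in B).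
have := HA j; rewrite (bigD1 j) //= big1 => [|k nkj].
  by rewrite addr0 mxE (negPf nB) eqxx mulr1.
rewrite mxE; case: ifP => [/vB->|_]; first by rewrite mul0r.
by rewrite eq_sym (negPf nkj) mulr0.
Qed.

Local Notation N := (n * n + n)%N.
Local Notation pol := {mpoly R[N]}.

Definition generic_M : 'M[pol]_n := \matrix_(i, j) 'X_(lshift n (mxvec_index i j)).
Definition generic_q : 'cV[pol]_n := \col_i 'X_(rshift (n * n) i).
Definition generic_A B : 'M[pol]_n :=
  \matrix_(i, j) (if j \in B then - generic_M i j else (i == j)%:R).
(** Cramer's numerator times the determinant, that is, the squared determinant times the coordinate
    of the solution: it has the sign of that coordinate whatever the sign of the determinant. *)
Definition lcp_poly (Bi : {set 'I_n} * 'I_n) : pol :=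
  \det (generic_A Bi.1) * (\adj (generic_A Bi.1) *m generic_q) Bi.2 0.

Definition lcp_point M q : 'I_N -> R := row_mx (mxvec M) q^T 0.

Lemma meval_generic_M M q : map_mx (meval (lcp_point M q)) generic_M = M.
Proof. by apply/matrixP => i j; rewrite !mxE mevalXU /lcp_point row_mxEl mxvecE. Qed.

Lemma meval_generic_q M q : map_mx (meval (lcp_point M q)) generic_q = q.
Proof.
by apply/matrixP => i j; rewrite !mxE mevalXU /lcp_point row_mxEr mxE (ord1 j).
Qed.

Lemma meval_generic_A M q B : map_mx (meval (lcp_point M q)) (generic_A B) = A_mat M B.
Proof.
have EM i j : (generic_M i j).@[lcp_point M q] = M i j.
  by rewrite -[in RHS](meval_generic_M M q) [RHS]mxE.
apply/matrixP => i j; rewrite [LHS]mxE [RHS]mxE [generic_A B i j]mxE.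
by case: ifP => _; [rewrite mevalN EM|rewrite /= rmorph_nat].
Qed.

Lemma meval_lcp_poly M q B i : A_mat M B \in unitmx ->
  (lcp_poly (B, i)).@[lcp_point M q] = (\det (A_mat M B)) ^+ 2 * Ainvq M q B i.
Proof.
move=> UA; rewrite /Ainvq /invmx UA -scalemxAl mxE mulrA expr2 mulfK -?unitfE -?unitmxE //.
rewrite /lcp_poly mevalM -!(meval_generic_A M q) /=.
rewrite -(det_map_mx (meval (lcp_point M q))).
congr (_ * _); rewrite -map_mx_adj -[X in _ = (_ *m X) _ _](meval_generic_q M q).
by rewrite -map_mxM [RHS]mxE.
Qed.

Lemma mdeg_le_det m (A : 'M[pol]_m) :
  (forall i j, mdeg_le 1 (A i j)) -> mdeg_le m (\det A).
Proof.
move=> HA; apply: mdeg_le_sum => s _; rewrite mulr_sign.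
have H : mdeg_le m (\prod_i A i (s i)).
  by have := @mdeg_le_prod _ _ 1 _ (fun i => A i (s i)) (fun i => HA i (s i)); rewrite card_ord muln1.
by case: ifP => // _; apply: mdeg_leN.
Qed.

Lemma mdeg_le_lcp_poly Bi : mdeg_le n.*2.+1 (lcp_poly Bi).
Proof.
(* The degree splits as [n] for the determinant, [n] as a generous bound for a cofactor, and 1 for
   the entry of [q]. *)
case: Bi => B i; rewrite -addnn -addnS; apply: mdeg_leM.
  apply: mdeg_le_det => k l; rewrite mxE; case: ifP => _.
    by apply: mdeg_leN; rewrite mxE -(mdeg1 (lshift n (mxvec_index k l))); apply: mdeg_leX.
  by rewrite -mpolyC_nat; apply: mdeg_leC.
rewrite mxE -addn1; apply: mdeg_le_sum => k _; apply: mdeg_leM.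
  rewrite mxE /cofactor -signr_odd mulr_sign.
  have H : mdeg_le n (\det (row' k (col' i (generic_A B)))).
    apply: (@mdeg_leW _ _ n.-1); first exact: leq_pred.
    apply: mdeg_le_det => k' l'; rewrite !mxE; case: ifP => _.
      by apply: mdeg_leN; rewrite -(mdeg1 (lshift n (mxvec_index (lift k k') (lift i l')))); apply: mdeg_leX.
    by rewrite -mpolyC_nat; apply: mdeg_leC.
  by case: ifP => // _; apply: mdeg_leN.
by rewrite mxE -(mdeg1 (rshift (n * n) k)); apply: mdeg_leX.
Qed.

(** The value [true] stands for a positive sign, thus for an incoming edge, in agreement with
    [signed]. *)
Definition sign_pattern (s : outmap n) : {ffun {set 'I_n} * 'I_n -> bool} :=
  [ffun Bi : {set 'I_n} * 'I_n => Bi.2 \notin s [ffun j => j \in Bi.1]].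

Lemma BsetK B : Bset [ffun j => j \in B] = B.
Proof. by apply/setP => j; rewrite inE ffunE. Qed.

Lemma vertexK (v : vertex n) : [ffun j => j \in Bset v] = v.
Proof. by apply/ffunP => j; rewrite ffunE inE. Qed.

Lemma sign_pattern_inj : injective sign_pattern.
Proof.
move=> s t E; apply/ffunP => v; apply/setP => i.
have /ffunP/(_ (Bset v, i)) := E; rewrite !ffunE /= vertexK.
by move/negb_inj.
Qed.

Lemma num_PUSO_le_poly :
  (num_PUSO R n <= (2 ^ n * n * n.*2.+1).*2.+1 ^ N)%N.
Proof.
rewrite /num_PUSO -(card_imset _ sign_pattern_inj).
have -> : (2 ^ n * n)%N = #|{: {set 'I_n} * 'I_n}|.
  by rewrite card_prod card_ord -cardsT -powersetT card_powerset cardsT card_ord.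
apply: (sign_pattern_card mdeg_le_lcp_poly) => sigma /imsetP[s].
rewrite inE => /asboolP[_ [M [q [PM nd ind]]]] ->.
exists (lcp_point M q) => -[B i]; rewrite ffunE /=.
have UA := A_mat_unit B PM.
have d0 : 0 < \det (A_mat M B) ^+ 2.
  by rewrite lt_def sqr_ge0 andbT expf_neq0 // -unitfE -unitmxE.
rewrite ind BsetK /signed; have [lt|le] /= := ltP (Ainvq M q B i) 0.
  by rewrite mevalN meval_lcp_poly // -mulrN mulr_gt0 // oppr_gt0.
by rewrite meval_lcp_poly // mulr_gt0 // lt_def nd.
Qed.

Lemma num_PUSO_upper : (0 < n)%N -> (num_PUSO R n <= 2 ^ (12 * n ^ 3))%N.
Proof.
move=> n0; apply: leq_trans num_PUSO_le_poly _.
have n2 : (n < 2 ^ n)%N by apply: ltn_expl.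
(* With [x = 2 ^ n > n] the base is at most [4 x ^ 3 <= x ^ 6]. The final exponent [6 n (n ^ 2 + n)]
   is at most [12 n ^ 3]. *)
have H : ((2 ^ n * n * n.*2.+1).*2.+1 <= 2 ^ (6 * n))%N.
  have -> : (2 ^ (6 * n) = (2 ^ n) ^ 6)%N by rewrite mulnC expnM.
  move: n2; move: (2 ^ n)%N => x n2.
  have x2 : (2 <= x)%N by lia.
  apply: (@leq_trans (x * x * (2 * x) * 2)); first by nia.
  by rewrite !expnS expn0 muln1; nia.
apply: (@leq_trans ((2 ^ (6 * n)) ^ N)); first by rewrite leq_exp2r ?addn_gt0 ?n0 ?orbT.
rewrite -expnM leq_exp2l // !expnS expn0; nia.
Qed.

End UpperBound.

(** * The lower bound *)

Section ThresholdUSO.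
Variables (n : nat) (T : {set 'I_n}) (h : nat) (w : 'I_n -> 'I_n -> nat).

Definition load (v : vertex n) i := (\sum_(j | (j \notin T) && v j) w i j)%N.

(** Edges outside [T] point to the value 1; edges in [T] point to the truth value of the threshold
    test, which depends only on coordinates outside [T]. *)
Definition threshold_outmap : outmap n :=
  [ffun v : vertex n => [set i | if i \in T then v i (+) (h < load v i)%N else ~~ v i]].

Lemma load_eq (v u : vertex n) i : (forall j, j \notin T -> v j = u j) -> load v i = load u i.
Proof.
by move=> E; apply: eq_bigl => j; have [//|jT /=] := boolP (j \in T); rewrite E.
Qed.

Lemma in_subcube (v u : vertex n) (C : {set 'I_n}) :
  (u \in subcube v C) = [forall i, (i \notin C) ==> (u i == v i)].
Proof.
apply/imsetP/forallP => [[I]|H].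
  rewrite powersetE => /subsetP IC -> i; apply/implyP => iC.
  rewrite ffunE; have /negPf -> : i \notin I by apply: contra iC; apply: IC.
  by rewrite addbF.
exists [set i | u i != v i].
  rewrite powersetE; apply/subsetP => i; rewrite inE; apply: contraR => iC.
  by have := H i; rewrite iC.
by apply/ffunP => i; rewrite ffunE inE; case: (u i); case: (v i).
Qed.

(** At a sink the free coordinates outside [T] must be 1; this fixes all loads, and the loads fix
    the free coordinates in [T]. *)
Lemma threshold_outmap_USO : is_USO threshold_outmap.
Proof.
split=> [v i|v C].
  rewrite !ffunE !inE; case: ifP => iT; last by rewrite ffunE inE eqxx addbT negbK.
  rewrite (@load_eq (flip v [set i]) v) => [|j jT].
    by rewrite ffunE inE eqxx addbT addNb negbK.
  by rewrite ffunE inE; case: eqP => [E|_]; [rewrite E iT in jT|rewrite addbF].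
pose u : vertex n := [ffun i => (i \in C) || v i].
pose w0 : vertex n := [ffun i => if (i \in C) && (i \in T) then (h < load u i)%N else u i].
have Lw0 i : load w0 i = load u i.
  by apply: load_eq => j jT; rewrite ffunE (negPf jT) andbF.
apply/eqP/cards1P; exists w0; apply/setP => x; rewrite !inE in_subcube.
apply/andP/eqP => [[/forallP Hx /eqP Hs]|->].
  have Hs' i : i \in C -> i \notin threshold_outmap x.
    by move=> iC; apply/negP => Hi; have := in_set0 i; rewrite -Hs inE Hi iC.
  have Hu j : j \notin T -> x j = u j.
    move=> jT; rewrite ffunE; case: (boolP (j \in C)) => [/Hs'|jC].
      by rewrite ffunE inE (negPf jT) negbK.
    by have := Hx j; rewrite jC => /eqP.
  apply/ffunP => i; rewrite ffunE; case: (boolP (i \in C)) => [iC|iC] /=.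
    case: ifP => [iT|/negbT /Hu //].
    have := Hs' i iC; rewrite ffunE inE iT (load_eq _ Hu).
    by case: (x i); case: (_ < _)%N.
  by have := Hx i; rewrite iC ffunE (negPf iC) => /eqP.
split.
  by apply/forallP => i; apply/implyP => iC; rewrite !ffunE (negPf iC).
apply/eqP/setP => i; rewrite !inE ffunE inE Lw0 ffunE.
case: (boolP (i \in C)) => [iC|]; last by rewrite andbF.
by case: ifP => iT /=; rewrite andbT ?iT; [rewrite addbb|rewrite ffunE iC].
Qed.

Variable R : rcfType.

(* Only the identity permutation contributes to the Leibniz formula. *)
Lemma det_bipartite m (S : pred 'I_m) (A : 'M[R]_m) :
  (forall i j, i != j -> A i j != 0 -> S i && ~~ S j) -> \det A = \prod_i A i i.
Proof.
move=> HA; rewrite /determinant (bigD1 (1%g : {perm 'I_m})) //= perm.odd_perm1 expr0 mul1r.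
rewrite [X in _ + X]big1 ?addr0 => [|s s1]; first by apply: eq_bigr => i _; rewrite perm.perm1.
have [i si] : exists i, s i != i.
  apply/existsP; apply: contraR s1; rewrite negb_exists => /forallP H.
  by apply/eqP/perm.permP => i; rewrite perm.perm1; apply/eqP; have := H i; rewrite negbK.
apply/eqP; rewrite mulf_eq0; apply/orP; right; rewrite prodf_seq_eq0.
apply/hasP; apply: NNPP => Hne.
have nz k : A k (s k) != 0.
  by apply/negP => Hk; apply: Hne; exists k => //; rewrite mem_index_enum.
(* For a moved point [i], a nonzero term gives [~~ S (s i)] by row [i] and [S (s i)] by row
   [s i]. *)
have /andP[_ nSi] : S i && ~~ S (s i) by apply: HA; rewrite ?nz // eq_sym.
have /andP[Si _] : S (s i) && ~~ S (s (s i)).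
  by apply: HA => //; rewrite (inj_eq perm.perm_inj) eq_sym.
by rewrite Si in nSi.
Qed.

(** The weights are doubled against the odd entries [h.*2.+1] of [threshold_q], so that parity
    excludes ties. *)
Definition threshold_M : 'M[R]_n :=
  \matrix_(i, j) (if i == j then 1 else if (i \in T) && (j \notin T) then - ((w i j).*2)%:R else 0).
Definition threshold_q : 'cV[R]_n := \col_i (if i \in T then (h.*2.+1)%:R else -1).

Lemma threshold_K_matrix : K_matrix threshold_M.
Proof.
split=> [i j nij|S].
  by rewrite mxE (negPf nij); case: ifP => // _; rewrite oppr_le0.
rewrite (@det_bipartite _ (fun k => enum_val k \in T)) => [|i j nij].
  by rewrite prodr_gt0 // => i _; rewrite !mxE eqxx.
by rewrite !mxE (inj_eq enum_val_inj) (negPf nij); case: ifP => //; rewrite eqxx.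
Qed.

(** Solved by substitution: rows outside [T] contain only their diagonal entry, and rows in [T] then
    collect twice the load. *)
Lemma threshold_Ainvq (v : vertex n) i : Ainvq threshold_M threshold_q (Bset v) i =
  if i \in T then (-1) ^+ v i * ((h.*2.+1)%:R - ((load v i).*2)%:R) else - (-1) ^+ v i.
Proof.
set A := A_mat threshold_M (Bset v).
pose x : 'cV[R]_n := \col_i (if i \in T
  then (-1) ^+ v i * ((h.*2.+1)%:R - ((load v i).*2)%:R) else - (-1) ^+ v i).
have Aii j : A j j = (-1) ^+ v j.
  by rewrite !mxE inE eqxx; case: (v j); rewrite ?expr1 ?expr0.
have Aij k l : k != l -> A k l = if (k \in T) && (l \notin T) && v l then ((w k l).*2)%:R else 0.
  move=> nkl; rewrite !mxE inE (negPf nkl); case: (v l); rewrite ?andbF ?andbT //.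
  by case: ifP; rewrite ?opprK ?oppr0.
have UA : A \in unitmx.
  rewrite unitmxE unitfE (@det_bipartite _ (mem T)) => [|k l nkl].
    by apply/prodf_neq0 => k _; rewrite Aii signr_eq0.
  by rewrite Aij //; case: ifP => [/andP[]//|_]; rewrite eqxx.
have signK (b : bool) : (-1) ^+ b * (-1) ^+ b = 1 :> R by rewrite -signr_addb addbb.
suff -> : threshold_q = A *m x by rewrite /Ainvq -/A mulKmx // mxE.
apply/colP => k; rewrite [LHS]mxE [RHS]mxE (bigD1 k) //= Aii mxE.
case: ifP => kT; last first.
  rewrite big1 ?addr0 ?mulrN ?signK // => l nlk.
  by rewrite Aij ?kT ?mul0r // eq_sym.
rewrite mulrA signK mul1r.
suff -> : \sum_(l | l != k) A k l * x l 0 = ((load v k).*2)%:R by rewrite subrK.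
rewrite /load -muln2 big_distrl natr_sum big_mkcond [RHS]big_mkcond /=; apply: eq_bigr => l _.
case: (eqVneq l k) => [->|nlk] /=; first by rewrite kT.
rewrite Aij ?kT 1?eq_sym //= mxE; case: (boolP (l \in T)) => lT /=; first by rewrite mul0r.
by case: (v l); rewrite ?mul0r // expr1 opprK mulr1 muln2.
Qed.

Lemma threshold_Ainvq_neq0 : Defs.nondegenerate threshold_M threshold_q.
Proof.
move=> B i; have -> : B = Bset ([ffun j => j \in B] : vertex n).
  by apply/setP => j; rewrite inE ffunE.
rewrite threshold_Ainvq; case: ifP => _; last by rewrite oppr_eq0 signr_eq0.
rewrite mulf_neq0 ?signr_eq0 // subr_eq0 eqr_nat; apply/eqP => /(congr1 odd).
by rewrite /= !odd_double.
Qed.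

Lemma threshold_induced : induced_by threshold_M threshold_q threshold_outmap.
Proof.
move=> v i; rewrite threshold_Ainvq ffunE inE; case: ifP => _.
  case: (v i); rewrite ?expr1 ?expr0 ?mulN1r ?mul1r ?oppr_lt0 ?subr_gt0 ?subr_lt0 ltr_nat.
    by rewrite addTb; lia.
  by rewrite addFb; lia.
by case: (v i); rewrite ?expr1 ?expr0 ?opprK ?oppr_lt0 ?ltr10 ?ltr01.
Qed.

Lemma threshold_KUSO : is_KUSO R threshold_outmap.
Proof.
split; first exact: threshold_outmap_USO.
exists threshold_M, threshold_q; split.
- exact: threshold_K_matrix.
- exact: threshold_Ainvq_neq0.
- exact: threshold_induced.
Qed.

End ThresholdUSO.

(** * Recovering the parameters with binary weights *)

Lemma binary_expansion K r : (r < 2 ^ K)%N ->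
  exists P : nat -> bool, (\sum_(d < K) P d * 2 ^ d)%N = r.
Proof.
elim: K r => [|K IH] r Hr; first by exists xpred0; rewrite big_ord0; case: r Hr.
have [lt|le] := ltnP r (2 ^ K).
  have [P HP] := IH r lt; exists (fun d => (d < K)%N && P d).
  rewrite big_ord_recr /= ltnn mul0n addn0 -[RHS]HP.
  by apply: eq_bigr => d _; rewrite ltn_ord.
have [|P HP] := IH (r - 2 ^ K)%N; first by move: Hr; rewrite expnS; lia.
exists (fun d => (d == K) || P d); rewrite big_ord_recr /= eqxx mul1n.
rewrite -[RHS](subnK le) -[in RHS]HP; congr (_ + _)%N.
by apply: eq_bigr => d _; rewrite ltn_eqF.
Qed.

Section LowerBound.
Variables (R : rcfType) (n K : nat).
Hypothesis K3 : (3 * K <= n)%N.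

Local Notation params := {ffun 'I_K * 'I_K -> 'I_(2 ^ K)}.

Definition param_at (a : params) (x y : nat) : nat :=
  if (insub x, insub y) is (Some i, Some j) then val (a (i, j)) else 0.

Lemma param_atE a (i j : 'I_K) : param_at a i j = a (i, j).
Proof. by rewrite /param_at !valK. Qed.

(* Coordinates [< K] are tests, [K .. 2K-1] carry the entries to be read off, and
   [2K .. 3K-1] have weights [1, 2, 4, ...], so that they can supply any offset [< 2 ^ K]. *)
Definition cube_weight (a : params) (i j : nat) : nat :=
  if (j < 2 * K)%N then param_at a i (j - K)%N
  else if (j < 3 * K)%N then (2 ^ (j - 2 * K))%N else 0.

Definition test_coords : {set 'I_n} := [set i : 'I_n | (i < K)%N].

Definition param_outmap (a : params) : outmap n :=
  threshold_outmap test_coords (2 ^ K).-1 (fun i j => cube_weight a i j).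

(** Selects the entry column [y] and the ruler weights in [P], with all test coordinates at 0. *)
Definition probe (y : nat) (P : nat -> bool) : vertex n :=
  [ffun x : 'I_n => if (x < 2 * K)%N then x == (K + y)%N :> nat
                    else (x < 3 * K)%N && P (x - 2 * K)%N].

Lemma load_probe (a : params) (i : 'I_n) (i' y : 'I_K) P : i = i' :> nat ->
  load test_coords (fun i j => cube_weight a i j) (probe y P) i
  = (a (i', y) + \sum_(d < K) P d * 2 ^ d)%N.
Proof.
move=> Ei; rewrite /load big_mkcond /=.
(* Written as a function on [nat], the summand can be summed separately over the blocks cut at [K],
   [2 * K] and [3 * K]. *)
pose F (x : nat) := if (x < K)%N then 0%N else if (x < 2 * K)%N then ((x == K + y) * param_at a i' (x - K))%N
  else if (x < 3 * K)%N then (P (x - 2 * K) * 2 ^ (x - 2 * K))%N else 0%N.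
rewrite (eq_bigr (fun x : 'I_n => F x)) => [|x _]; last first.
  rewrite inE ffunE /F /cube_weight Ei; case: (ltnP x K) => //= _.
  case: (ltnP x (2 * K)) => _; first by case: eqP; rewrite ?mul1n ?mul0n.
  by case: (ltnP x (3 * K)) => _ //=; case: (P _); rewrite ?mul1n ?mul0n.
rewrite -(big_mkord xpredT F).
rewrite (@big_cat_nat _ _ _ K) //=; last by lia.
rewrite (@big_cat_nat _ _ _ (2 * K)%N K) //=; try lia.
rewrite (@big_cat_nat _ _ _ (3 * K)%N (2 * K)%N) //=; try lia.
rewrite [X in (X + _)%N]big_nat_cond big1 => [|x /andP[/andP[_ ltx] _]]; last by rewrite /F ltx.
rewrite add0n; congr (_ + _)%N.
  rewrite -{1}[K]add0n big_addn (_ : (2 * K - K = K)%N); last by lia.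
  rewrite big_mkord (bigD1 y) //= big1 ?addn0 => [|d /eqP nd].
    rewrite /F addnC ltnNge leq_addr /= eqxx mul1n addKn -param_atE.
    by have -> : (K + y < 2 * K)%N by have := ltn_ord y; lia.
  rewrite /F; have -> : (d + K < K)%N = false by lia.
  have -> : (d + K < 2 * K)%N by have := ltn_ord d; lia.
  case: eqP => // E; case: nd; apply: val_inj => /=; lia.
rewrite [X in (_ + X)%N]big_nat_cond [X in (_ + X)%N]big1 => [|x /andP[/andP[lex _] _]]; last first.
  rewrite /F; do 3 (case: ifP; first by lia); by [].
rewrite addn0 -{1}[(2 * K)%N]add0n big_addn (_ : (3 * K - 2 * K = K)%N); last by lia.
rewrite big_mkord; apply: eq_bigr => d _; rewrite /F addnK.
have -> : (d + 2 * K < K)%N = false by lia.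
have -> : (d + 2 * K < 2 * K)%N = false by lia.
by have -> : (d + 2 * K < 3 * K)%N by have := ltn_ord d; lia.
Qed.

(** If two entries differ, the ruler offset that lifts the smaller one exactly to the threshold
    [(2 ^ K).-1] makes only the larger one pass the strict test. *)
Lemma param_outmap_inj : injective param_outmap.
Proof.
move=> a b E; apply/ffunP => -[i' y]; apply: val_inj => /=.
have iP : (i' < n)%N by have := ltn_ord i'; lia.
pose i := Ordinal iP.
have H (P : nat -> bool) : ((2 ^ K).-1 < a (i', y) + \sum_(d < K) P d * 2 ^ d)%N
         = ((2 ^ K).-1 < b (i', y) + \sum_(d < K) P d * 2 ^ d)%N.
  have /ffunP/(_ (probe y P))/setP/(_ i) := E.
  by rewrite !ffunE !inE (ltn_ord i') !(@load_probe _ i i' y P erefl) => /addbI.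
have reach x : (x < 2 ^ K)%N -> exists P : nat -> bool, (x + \sum_(d < K) P d * 2 ^ d = (2 ^ K).-1)%N.
  move=> ltx; have [|P HP] := @binary_expansion K ((2 ^ K).-1 - x); first by lia.
  by exists P; rewrite HP; lia.
have [lt|lt|//] := ltngtP (a (i', y)) (b (i', y)).
  by have [P HP] := reach _ (ltn_ord (a (i', y))); have := H P; lia.
by have [P HP] := reach _ (ltn_ord (b (i', y))); have := H P; lia.
Qed.

Lemma num_KUSO_lower : (2 ^ (K ^ 3) <= num_KUSO R n)%N.
Proof.
have -> : (2 ^ (K ^ 3) = #|{: params}|)%N.
  by rewrite card_ffun card_prod !card_ord -expnM; congr (2 ^ _)%N; rewrite !expnS; lia.
rewrite -cardsT -(card_imset _ param_outmap_inj); apply: subset_leq_card.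
apply/subsetP => _ /imsetP[a _ ->]; rewrite inE; apply/asboolP.
exact: threshold_KUSO.
Qed.

End LowerBound.

Lemma KUSO_is_PUSO (R : rcfType) n (s : outmap n) : is_KUSO R s -> is_PUSO R s.
Proof. by move=> [U [M [q [[_ PM] nd ind]]]]; split=> //; exists M, q. Qed.

Lemma num_KUSO_le_PUSO (R : rcfType) n : (num_KUSO R n <= num_PUSO R n)%N.
Proof.
apply: subset_leq_card; apply/subsetP => s; rewrite !inE => /asboolP Ks.
exact/asboolP/KUSO_is_PUSO.
Qed.

(* Lower bound 2^{Omega(n^3)} for K-USOs, and the consequence that the numbers
   of K-USOs and P-USOs are both 2^{Theta(n^3)}.  "count >= 2^{c n^3}" with
   c = 1/k is written 2^(n^3) <= count^k. *)
Theorem mainTheorem5 (R : rcfType) :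
  exists (k C n0 : nat), (0 < k)%N /\
    forall n : nat, (n0 <= n)%N ->
      [/\ (2 ^ (n ^ 3) <= (num_KUSO R n) ^ k)%N,
          (2 ^ (n ^ 3) <= (num_PUSO R n) ^ k)%N,
          (num_KUSO R n <= 2 ^ (C * n ^ 3))%N &
          (num_PUSO R n <= 2 ^ (C * n ^ 3))%N].
Proof.
(* For [n >= 3] one has [n <= 5 * K] with [K = n %/ 3], with equality at [n = 5]; hence
   [125 = 5 ^ 3]. The 12 is the constant of [num_PUSO_upper]. *)
exists 125%N, 12%N, 3%N; split=> // n n3.
pose K := (n %/ 3)%N.
have K3 : (3 * K <= n)%N by rewrite mulnC leq_trunc_div.
have nK : (n <= 5 * K)%N by rewrite /K; lia.
have lower : (2 ^ (n ^ 3) <= num_KUSO R n ^ 125)%N.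
  apply: (@leq_trans ((2 ^ (K ^ 3)) ^ 125)); last by rewrite leq_exp2r // num_KUSO_lower.
  rewrite -expnM leq_exp2l // (_ : (K ^ 3 * 125 = (5 * K) ^ 3)%N); last by rewrite expnMn mulnC.
  by rewrite leq_exp2r.
have upper : (num_PUSO R n <= 2 ^ (12 * n ^ 3))%N by apply: num_PUSO_upper; lia.
have KP := num_KUSO_le_PUSO R n.
split=> //; first by apply: leq_trans lower _; rewrite leq_exp2r.
exact: leq_trans KP upper.
Qed.
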